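(* Let $k$ be a field of characteristic zero. Then the path algebra $k\Theta(3)$ of the generalised Kronecker quiver $\Theta(3)$ is not of amenable representation type.
   Context: The generalised Kronecker quiver $\Theta(d)$ has two vertices $1,2$ and exactly $d$ arrows, all going from $1$ to $2$. Modules over $k\Theta(d)$ are identified with representations of $\Theta(d)$ over $k$. Let $A$ be a finite dimensional $k$-algebra and let $\mathcal{M}$ be a set of finite dimensional $A$-modules. $\mathcal{M}$ is hyperfinite if for every $\varepsilon > 0$ there exists a number $L_\varepsilon > 0$ such that for every $M \in \mathcal{M}$ there exist a submodule $N \subseteq M$ with $\dim_k N \geq (1-\varepsilon)\dim_k M$ and finite dimensional $A$-modules $N_1,\dots,N_t$ with $\dim_k N_i \leq L_\varepsilon$ for all $i$, such that $N \cong \bigoplus_{i=1}^t N_i$. The algebra $A$ is of amenable representation type if the set of all finite dimensional $A$-modules (more precisely, a set meeting every isomorphism class of finite dimensional $A$-modules) is hyperfinite. *)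

(* Defs.v *)
From HB Require Import structures.
From mathcomp Require Import all_boot all_order all_algebra all_field.
From mathcomp Require Import reals.

Set Implicit Arguments.
Unset Strict Implicit.
Unset Printing Implicit Defensive.

Import Order.TTheory GRing.Theory Num.Theory.
Local Open Scope ring_scope.

(* Modules are left modules. *)
Record fdmod (k : fieldType) (A : falgType k) := FdMod {
  carrier :> vectType k;
  act : A -> carrier -> carrier;
  act_linearl : forall v, linear (act^~ v);
  act_linearr : forall a, linear (act a);
  act1 : forall v, act 1 v = v;
  actM : forall a b v, act (a * b) v = act a (act b v)
}.

Section Modules.
Variables (k : fieldType) (A : falgType k).
Implicit Types M N : fdmod A.

Definition mdim M : nat := \dim (fullv : {vspace M}).

Definition is_submod M (U : {vspace M}) : Prop :=
  forall (a : A) (u : M), u \in U -> act a u \in U.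

Section Submodule.
Variables (M : fdmod A) (U : {vspace M}) (hU : is_submod U).

(* hU makes act a (vsval u) lie in U, so vsproj only changes its type. *)
Definition sub_act (a : A) (u : subvs_of U) : subvs_of U :=
  vsproj U (act a (vsval u)).

Lemma val_sub_act a u : vsval (sub_act a u) = act a (vsval u).
Proof. by rewrite /sub_act vsprojK //; apply/hU/subvsP. Qed.

Fact sub_act_linearl u : linear (sub_act^~ u).
Proof. by move=> c a b; rewrite /sub_act act_linearl linearP. Qed.

Fact sub_act_linearr a : linear (sub_act a).
Proof. by move=> c u v; rewrite /sub_act linearP act_linearr linearP. Qed.

Fact sub_act1 u : sub_act 1 u = u.
Proof. by apply: val_inj; rewrite /= val_sub_act act1. Qed.

Fact sub_actM a b u : sub_act (a * b) u = sub_act a (sub_act b u).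
Proof. by apply: val_inj; rewrite /= !val_sub_act actM. Qed.

Definition submod : fdmod A :=
  FdMod sub_act_linearl sub_act_linearr sub_act1 sub_actM.

End Submodule.

Section ZeroModule.

Definition zero_act (a : A) (u : 'rV[k]_0) : 'rV[k]_0 := u.

Fact zero_act_linearl u : linear (zero_act^~ u).
Proof. by move=> c a b; rewrite !(thinmx0 (_ : 'rV_0)). Qed.

Fact zero_act_linearr a : linear (zero_act a).
Proof. by []. Qed.

Fact zero_act1 u : zero_act 1 u = u.
Proof. by []. Qed.

Fact zero_actM a b u : zero_act (a * b) u = zero_act a (zero_act b u).
Proof. by []. Qed.

Definition zeromod : fdmod A :=
  FdMod zero_act_linearl zero_act_linearr zero_act1 zero_actM.

End ZeroModule.

Section DirectSum.
Variables M N : fdmod A.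

Definition dsum_act (a : A) (u : M * N) : M * N := (act a u.1, act a u.2).

Fact dsum_act_linearl u : linear (dsum_act^~ u).
Proof. by move=> c a b; rewrite /dsum_act !act_linearl. Qed.

Fact dsum_act_linearr a : linear (dsum_act a).
Proof. by move=> c u v; rewrite /dsum_act /= !act_linearr. Qed.

Fact dsum_act1 u : dsum_act 1 u = u.
Proof. by case: u => u v; rewrite /dsum_act !act1. Qed.

Fact dsum_actM a b u : dsum_act (a * b) u = dsum_act a (dsum_act b u).
Proof. by rewrite /dsum_act !actM. Qed.

Definition dsum2 : fdmod A :=
  FdMod dsum_act_linearl dsum_act_linearr dsum_act1 dsum_actM.

End DirectSum.

Definition dsum (t : nat) (Ns : 'I_t -> fdmod A) : fdmod A :=
  \big[dsum2/zeromod]_(i < t) Ns i.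

Definition mod_iso M N : Prop :=
  exists f : 'Hom(M, N),
    bijective f /\ forall (a : A) (u : M), f (act a u) = act a (f u).

Definition hyperfinite (R : realType) (Ms : fdmod A -> Prop) : Prop :=
  forall eps : R, 0 < eps ->
  exists L : R, 0 < L /\
  forall M, Ms M ->
  exists (U : {vspace M}) (hU : is_submod U),
    (mdim (submod hU))%:R >= (1 - eps) * (mdim M)%:R /\
    exists (t : nat) (Ns : 'I_t -> fdmod A),
      (forall i, (mdim (Ns i))%:R <= L) /\
      mod_iso (submod hU) (dsum Ns).

End Modules.

Definition amenable_rep_type (R : realType) (k : fieldType) (A : falgType k) :
  Prop := hyperfinite R (fun _ : fdmod A => True).

Section KroneckerPathAlgebra.
Variables (k : fieldType) (d : nat).

(* The paths of the generalised Kronecker quiver: inl v is the trivial path   *)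
(* at v, with false and true standing for the vertices 1 and 2, and inr i is  *)
(* the i-th arrow from 1 to 2. No two arrows compose, so these are all paths. *)
Definition kpath : finType := (bool + 'I_d)%type.

Definition ksrc (p : kpath) : bool := if p is inl v then v else false.
Definition ktgt (p : kpath) : bool := if p is inl v then v else true.

(* The path "first q, then p", if it exists; with this order, left modules    *)
(* over the path algebra are the covariant representations of the quiver.     *)
Definition kcomp (p q : kpath) : option kpath :=
  if ksrc p == ktgt q then
    match p, q with
    | inl _, _ => Some q
    | _, inl _ => Some p
    | inr _, inr _ => None (* not reached: ksrc p <> ktgt q *)
    end
  else None.

(* An element is the family of its coefficients in the basis of paths. *)
Definition kronecker_alg := {ffun kpath -> k^o}.

HB.instance Definition _ := Vector.on kronecker_alg.

Implicit Types x y z : kronecker_alg.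

Definition kone : kronecker_alg := [ffun p => if p is inl _ then 1 else 0].

Definition kmul x y : kronecker_alg :=
  [ffun r => \sum_p \sum_(q | kcomp p q == Some r) x p * y q].

Lemma kmul_inl x y v : kmul x y (inl v) = x (inl v) * y (inl v).
Proof.
rewrite ffunE big_sumType /= [X in _ + X]big1 ?addr0 => [|i _]; last first.
  by rewrite big_pred0 // => -[[]|j].
rewrite (bigD1 v) //= [X in _ + X]big1 ?addr0 => [|w wv].
  by rewrite (big_pred1 (inl v)) //; case: v => -[[]|i].
by rewrite big_pred0 //; case: v w wv => -[] // _ [[]|i].
Qed.

Lemma kmul_inr x y i :
  kmul x y (inr i) = x (inl true) * y (inr i) + x (inr i) * y (inl false).
Proof.
rewrite ffunE big_sumType /= big_bool /=; congr (_ + _).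
  rewrite [X in _ + X]big_pred0 ?addr0 => [|[[]|j]] //.
  by rewrite (big_pred1 (inr i)) // => -[[]|j].
rewrite (bigD1 i) //= [X in _ + X]big1 ?addr0 => [|j ji].
  rewrite (big_pred1 (inl false)) // => -[[]|j] //=.
  by rewrite /kcomp /= !eqxx.
rewrite big_pred0 // => -[[]|l] //=; rewrite /kcomp /=.
by apply/negP => /eqP[ji']; rewrite ji' eqxx in ji.
Qed.

Fact kmulA : associative kmul.
Proof.
move=> x y z; apply/ffunP => -[v|i].
  by rewrite !kmul_inl mulrA.
by rewrite !kmul_inr !kmul_inl mulrDr mulrDl !mulrA addrA.
Qed.

Fact kmul1l : left_id kone kmul.
Proof.
move=> x; apply/ffunP => -[v|i]; rewrite ?kmul_inl ?kmul_inr !ffunE.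
  by rewrite mul1r.
by rewrite mul1r mul0r addr0.
Qed.

Fact kmul1r : right_id kone kmul.
Proof.
move=> x; apply/ffunP => -[v|i]; rewrite ?kmul_inl ?kmul_inr !ffunE.
  by rewrite mulr1.
by rewrite mulr1 mulr0 add0r.
Qed.

Fact kmulDl : left_distributive kmul +%R.
Proof.
move=> x y z; apply/ffunP => -[v|i].
  by rewrite [RHS]ffunE !kmul_inl ffunE mulrDl.
by rewrite [RHS]ffunE !kmul_inr !ffunE !mulrDl addrACA.
Qed.

Fact kmulDr : right_distributive kmul +%R.
Proof.
move=> x y z; apply/ffunP => -[v|i].
  by rewrite [RHS]ffunE !kmul_inl ffunE mulrDr.
by rewrite [RHS]ffunE !kmul_inr !ffunE !mulrDr addrACA.
Qed.

Fact kone_neq0 : kone != 0.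
Proof.
by apply/eqP => /ffunP/(_ (inl true))/eqP; rewrite !ffunE oner_eq0.
Qed.

HB.instance Definition _ := GRing.Zmodule_isNzRing.Build kronecker_alg
  kmulA kmul1l kmul1r kmulDl kmulDr kone_neq0.

Fact kscaleAl (c : k) x y : c *: (x * y) = (c *: x) * y.
Proof.
apply/ffunP => -[v|i]; rewrite [LHS]ffunE.
  by rewrite !kmul_inl ffunE scalerAl.
by rewrite !kmul_inr !ffunE scalerDr !scalerAl.
Qed.

HB.instance Definition _ :=
  GRing.Lmodule_isLalgebra.Build k kronecker_alg kscaleAl.

Fact kscaleAr (c : k) x y : c *: (x * y) = x * (c *: y).
Proof.
apply/ffunP => -[v|i]; rewrite [LHS]ffunE.
  by rewrite !kmul_inl ffunE scalerAr.
by rewrite !kmul_inr !ffunE scalerDr !scalerAr.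
Qed.

HB.instance Definition _ :=
  GRing.Lalgebra_isAlgebra.Build k kronecker_alg kscaleAr.

HB.instance Definition _ := Algebra_isFalgebra.Build k kronecker_alg.

End KroneckerPathAlgebra.

(* Main.v *)
Require Import Defs.
From HB Require Import structures.
From mathcomp Require Import all_boot all_order all_algebra all_field reals.
From mathcomp Require Import fingroup perm boolp mpoly zify lra.

(* A generic triple of n x n matrices is a local dimension expander: if n is  *)
(* large compared with L, every subspace W of dimension a <= L satisfies      *)
(* dim (W T_0 + W T_1 + W T_2) >= 2a. Indeed the triples mapping some W of    *)
(* dimension a into some space of dimension b < 2a depend polynomially on     *)
(* about 3n^2 - (2a - b)n parameters, fewer than the 3n^2 matrix entries, so  *)
(* these triples cannot fill k^(3n^2).                                        *)
(* For the module M = (k^n, k^n) given by such a triple, a module N of        *)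
(* dimension <= L embedded in M has dim N_2 >= 2 dim N_1, and this inequality *)
(* passes to direct sums. A submodule U of M that is a sum of modules of      *)
(* dimension <= L thus has dim U_1 <= dim U_2 / 2 <= n / 2, so dim U <= 3n/2, *)
(* whereas hyperfiniteness with eps = 1/8 asks for dim U >= 7n/4.             *)

Set Implicit Arguments.
Unset Strict Implicit.
Unset Printing Implicit Defensive.

Import Order.TTheory GRing.Theory Num.Theory.
Local Open Scope ring_scope.

(** * Sets too small to fill an affine space *)

Section ThinSets.
Variables (k : fieldType) (I : finType).

(** That the non-expanding triples do not fill the affine space is shown by counting instead of
    dimension theory. On the image of a polynomial map with N < #|I| parameters, products of at most
    D affine factors span only O(D^N) dimensions ([thin_image]), while on a grid of side H some #|I|
    H factors suffice to separate all H^#|I| points ([thin_avoid]). Finitely many parametrisations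
    cover the bad triples ([thin_bad]), which gives [expanding_triple]. The triple defines
    [triple_mod]. Its small submodules are [expansive] ([small_expansive]), and [dsum_expansive]
    extends this to sums of any number of small modules embedded in it, so such a sum stays too
    small for eps = 1/8. *)

Definition affprod (l : seq (I * k)) (x : I -> k) : k :=
  \prod_(p <- l) (x p.1 - p.2).

(* The restrictions to Z of the products of at most D affine factors span a   *)
(* space of dimension O(D^(#|I| - 1)), as they do on a proper subvariety.     *)
Definition thin (Z : (I -> k) -> Prop) : Prop :=
  exists C : nat, forall D : nat, (0 < D)%N ->
  exists r : nat, (r <= C * D ^ #|I|.-1)%N /\
  exists q : 'I_r -> (I -> k) -> k, forall l, (size l <= D)%N ->
  exists c : 'I_r -> k, forall x, Z x -> affprod l x = \sum_i c i * q i x.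

Lemma thin_sub (Z Z' : (I -> k) -> Prop) :
  (forall x, Z x -> Z' x) -> thin Z' -> thin Z.
Proof.
move=> ZZ' [C tC]; exists C => D /tC[r [rC [q tq]]]; exists r; split=> //.
by exists q => l /tq[c cq]; exists c => x /ZZ'/cq.
Qed.

Lemma thin0 : thin (fun=> False).
Proof.
exists 0%N => D _; exists 0%N; split=> //; exists (fun _ _ => 0) => l _.
by exists (fun=> 0).
Qed.

Lemma thinU (Z1 Z2 : (I -> k) -> Prop) :
  thin Z1 -> thin Z2 -> thin (fun x => Z1 x \/ Z2 x).
Proof.
move=> [C1 t1] [C2 t2]; exists (C1 + C2)%N => D D0.
have [r1 [rC1 [q1 tq1]]] := t1 D D0; have [r2 [rC2 [q2 tq2]]] := t2 D D0.
exists (r1 + r2)%N; split; first by rewrite mulnDl leq_add.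
(* The first family is cut off to [Z1] and the second to its complement, so the two expansions do
   not interfere where the sets overlap. *)
exists (fun i x => match split i with
  | inl j => if `[< Z1 x >] then q1 j x else 0
  | inr j => if `[< Z1 x >] then 0 else q2 j x end) => l lD.
have [c1 cq1] := tq1 l lD; have [c2 cq2] := tq2 l lD.
exists (fun i => match split i with inl j => c1 j | inr j => c2 j end) => x Zx.
rewrite big_split_ord /=.
under eq_bigr => i _ do rewrite (unsplitK (inl i)).
under [X in _ + X]eq_bigr => i _ do rewrite (unsplitK (inr i)).
case: asboolP => Z1x.
  by rewrite [X in _ + X]big1 ?addr0 => [|i _]; rewrite ?mulr0 // cq1.
by rewrite [X in X + _]big1 ?add0r => [|i _]; rewrite ?mulr0 // cq2 //;
  case: Zx.
Qed.

Lemma thin_exists (J : finType) (Z : J -> (I -> k) -> Prop) :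
  (forall j, thin (Z j)) -> thin (fun x => exists j, Z j x).
Proof.
move=> tZ; have: thin (fun x => exists2 j, j \in enum J & Z j x).
  elim: (enum J) => [|j s IHs]; first by apply: thin_sub thin0 => x [].
  apply: thin_sub (thinU (tZ j) IHs) => x [j']; rewrite inE => /predU1P[->|js].
    by left.
  by right; exists j'.
by apply: thin_sub => x [j Zj]; exists j; rewrite ?mem_enum.
Qed.

Lemma card_bmultinom N B : (#|{: 'X_{1..N < B}}| <= B ^ N)%N.
Proof.
have leB (m : 'X_{1..N < B}) i : (m i < B)%N.
  by rewrite (leq_ltn_trans _ (bmdeg m)) // mdegE (bigD1 i) //= leq_addr.
pose f m : {ffun 'I_N -> 'I_B} := [ffun i => Ordinal (leB m i)].
suff /leq_card : injective f by rewrite card_ffun !card_ord.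
move=> m1 m2 /ffunP m12; apply/val_inj/mnmP => i.
by have /(congr1 val) := m12 i; rewrite !ffunE.
Qed.

(** Pulled back along [p], a product of D affine factors is a polynomial in N variables of degree
    O(D), hence a combination of O(D^N) monomials, and N is at most #|I| - 1. *)
Lemma thin_image N (p : I -> {mpoly k[N]}) : (N < #|I|)%N ->
  thin (fun x => exists t : 'I_N -> k, forall i, x i = (p i).@[t]).
Proof.
(* One unit of slack covers a constant subtracted from a zero [p i], the other the successor lost at
   each factor in [msizeM_le]. *)
move=> NI; pose e := (\max_i msize (p i)).+2.
have pe i c : ((msize (p i - c%:MP)).+1 <= e)%N.
  rewrite ltnS (leq_trans (msizeD_le _ _)) // msizeN msizeC geq_max.
  apply/andP; split; last by case: (c != 0).
  by apply: leqW; rewrite (leq_bigmax i).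
exists (e.+1 ^ N)%N => D D0; pose B := (D * e).+1.
exists #|{: 'X_{1..N < B}}|; split.
  rewrite (leq_trans (card_bmultinom _ _)) //.
  rewrite (@leq_trans ((e.+1 * D) ^ N)) //; last first.
    rewrite expnMn leq_mul2l; apply/orP; right.
    by rewrite leq_pexp2l // -ltnS prednK // (leq_ltn_trans _ NI).
  by case: (N) => // n; rewrite leq_exp2r // /B mulSn mulnC -add1n leq_add2r.
(* Fixing one parameter for each point of the image turns monomials in the parameters into functions
   of x. *)
have /choice[pt ptP] (x : I -> k) : exists t' : 'I_N -> k,
    (exists t : 'I_N -> k, forall i, x i = (p i).@[t]) ->
    forall i, x i = (p i).@[t'].
  have [[t xt]|nx] :=
    pselect (exists t : 'I_N -> k, forall i, x i = (p i).@[t]).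
    by exists t.
  by exists (fun=> 0) => /nx.
exists (fun j x => mmap1 (pt x) (enum_val j : 'X_{1..N < B})) => l lD.
pose F := \prod_(ic <- l) (p ic.1 - ic.2%:MP).
have msF : (msize F <= B)%N.
  apply: (@leq_trans (size l * e).+1); last by rewrite ltnS leq_mul2r lD orbT.
  rewrite /F; elim: {lD F}l => [|[i c] l' IHl]; first by rewrite big_nil msize1.
  rewrite big_cons /= (leq_trans (msizeM_le _ _)) // mulSn.
  by rewrite -[X in (X <= _)%N]addSn -[X in (_ <= X)%N]addnS leq_add ?pe.
exists (fun j => F@_(enum_val j : 'X_{1..N < B})) => x /ptP xE.
transitivity (F.@[pt x]).
  rewrite /affprod /F rmorph_prod; apply: eq_bigr => -[i c] _ /=.
  by rewrite rmorphB /= mevalC -xE.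
rewrite /meval (mmapE _ msF) /= (reindex (@enum_val _ predT)) /=; last first.
  by apply: onW_bij; exact: enum_val_bij.
by [].
Qed.

(** In characteristic zero k contains grids of every side H. If [Z] were everything, H^#|I|
    independent functions on the grid would lie in a span of dimension at most C (#|I| H)^(#|I| -
    1), which is impossible for large H. *)
Lemma thin_avoid (Z : (I -> k) -> Prop) :
  [pchar k] =i pred0 -> (0 < #|I|)%N -> thin Z -> exists x, ~ Z x.
Proof.
move=> /pcharf0P k0 I0 [C tZ]; apply: contrapT => /forallNP allZ.
have natI (a b : nat) : (a%:R == b%:R :> k) = (a == b).
  wlog ab : a b / (a <= b)%N => [h|].
    by case/orP: (leq_total a b) => /h // ; rewrite eq_sym [RHS]eq_sym.
  by rewrite eq_sym -subr_eq0 -natrB // k0 subn_eq0 eqn_leq ab.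
have {}allZ x : Z x by apply: contrapT; exact: allZ.
(* Chosen so that C (#|I| H)^(#|I| - 1) < H^#|I|. *)
pose H := (C * #|I| ^ #|I|.-1).+1.
pose S := {ffun I -> 'I_H}; pose pt (s : S) i : k := (s i)%:R.
(* affprod (l s) vanishes on the grid S except at s, so these #|S| functions *)
(* are linearly independent.                                                 *)
pose l (s : S) := [seq (ic.1, (ic.2 : nat)%:R : k) | ic : I * 'I_H <-
   [seq (i, c) | i <- enum I, c <- enum 'I_H] & ic.2 != s ic.1].
have sl s : (size (l s) <= #|I| * H)%N.
  by rewrite size_map size_filter (leq_trans (count_size _ _)) // size_allpairs
     -!cardE card_ord.
have [r [rC [q tq]]] := tZ _ (leq_mul I0 (ltn0Sn _) : (0 < #|I| * H)%N).
have /choice[c cP] := fun s => tq (l s) (sl s).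
have apE s s' : (affprod (l s) (pt s') != 0) = (s == s').
  rewrite /affprod big_map big_filter /= prodf_seq_neq0.
  apply/allP/eqP => [ls|<-{s'} [i j] _].
    apply/ffunP => i; apply/eqP; rewrite eq_sym.
    have := ls (i, s' i); rewrite allpairs_f ?mem_enum // => /(_ isT)/implyP/=.
    by rewrite /pt subrr eqxx => /contraNT; apply.
  by apply/implyP; rewrite /pt subr_eq0 natI eq_sym.
pose C1 : 'M[k]_(#|S|, r) := \matrix_(i, j) c (enum_val i) j.
pose Q : 'M[k]_(r, #|S|) := \matrix_(j, i) q j (pt (enum_val i)).
have CQE : C1 *m Q =
    diag_mx (\row_i affprod (l (enum_val i)) (pt (enum_val i))).
  apply/matrixP => i j; rewrite !mxE; under eq_bigr => m _ do rewrite !mxE.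
  rewrite -cP //; case: eqVneq => [->|ij]; rewrite ?mulr1n // mulr0n.
  by apply: contraNeq ij; rewrite apE => /eqP/enum_val_inj->.
have CQU : C1 *m Q \in unitmx.
  rewrite CQE unitmxE det_diag unitfE; apply/prodf_neq0 => i _.
  by rewrite mxE apE.
have := leq_trans (mxrankM_maxl C1 Q) (rank_leq_col C1).
rewrite mxrank_unit // card_ffun card_ord leqNgt => /negP; apply.
rewrite (leq_ltn_trans rC) // expnMn mulnA -[X in (_ < _ ^ X)%N](prednK I0).
by rewrite expnS ltn_mul2r expn_gt0 ltnSn.
Qed.

End ThinSets.

(** * Local dimension expanders *)

Lemma perm_extend_inj a m (f : 'I_a -> 'I_(a + m)) : injective f ->
  exists s : 'S_(a + m), forall i, s (lshift m i) = f i.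
Proof.
move=> finj; pose A := ~: [set f i | i : 'I_a].
have cA : #|A| = m.
  by apply/eqP; rewrite -(eqn_add2l #|[set f i | i : 'I_a]|) cardsC
    card_imset // !card_ord.
pose g j := match split j with
  | inl i => f i | inr i => enum_val (cast_ord (esym cA) i) end.
have fA i j : f i != enum_val (cast_ord (esym cA) j).
  apply: contraTneq (enum_valP (cast_ord (esym cA) j)) => <-.
  by rewrite inE negbK imset_f.
have ginj : injective g.
  move=> i j; rewrite /g; case: splitP => i' ii'; case: splitP => j' jj'.
  - by move=> /finj ij; apply: val_inj; rewrite /= ii' jj' ij.
  - by move/eqP; rewrite (negPf (fA _ _)).
  - by move/eqP; rewrite eq_sym (negPf (fA _ _)).
  - by move/enum_val_inj/cast_ord_inj => ij; apply: val_inj;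
    rewrite /= ii' jj' ij.
exists (perm ginj) => i; rewrite permE /g.
by have := unsplitK (inl i : 'I_a + 'I_m) => /= ->.
Qed.

(** Some a columns of [X] are independent: move them to the front and factor out the invertible
    block [T] that they form. *)
Lemma row_free_perm_decomp (F : fieldType) a m (X : 'M[F]_(a, a + m)) :
  row_free X -> exists (s : 'S_(a + m)) (T : 'M_a) (X' : 'M_(a, m)),
    T \in unitmx /\ X = T *m row_mx 1%:M X' *m perm_mx s.
Proof.
move=> Xfree; have fullX : row_full X^T by rewrite /row_full mxrank_tr.
have [s sE] := perm_extend_inj (@fullrankfun_inj _ _ _ _ fullX).
pose T := lsubmx (col_perm s X); exists s, T.
have uT : T \in unitmx.
  rewrite -unitmx_tr -row_full_unit.
  have := fullrowsub_full fullX; congr (row_full _).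
  by apply/matrixP => i j; rewrite !mxE sE.
exists (invmx T *m rsubmx (col_perm s X)); split=> //.
rewrite mul_mx_row mulmx1 mulKVmx // hsubmxK col_permE -mulmxA -perm_mxM.
by rewrite mulVg perm_mx1 mulmx1.
Qed.

(** * Parametrising the triples that fail to expand *)

Section BadTriples.
Variables a m b : nat.
Let n := (a + m)%N.

Definition badparam : finType :=
  (('I_a * 'I_m) + ('I_3 * 'I_m * 'I_n) +
   (('I_3 * 'I_a * 'I_b) + ('I_b * 'I_n)))%type.

(* If W is the row space of [1 | X], then col_mx C B maps W into the row      *)
(* space of Y exactly when C + X B = P Y for some P; the permutation s allows *)
(* for any position of the pivots of W.                                       *)
Definition badtriple (R : comNzRingType) (s : 'S_n)
    (t : badparam -> R) (i : 'I_3) : 'M[R]_n :=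
  let X := \matrix_(r, c) t (inl (inl (r, c))) in
  let B := \matrix_(r, c) t (inl (inr (i, r, c))) in
  let P := \matrix_(r, c) t (inr (inl (i, r, c))) in
  let Y := \matrix_(r, c) t (inr (inr (r, c))) in
  perm_mx s *m col_mx (P *m Y - X *m B) B.

(** Serves to specialise the generic triple, whose parameters are indeterminates, to actual
    values. *)
Lemma map_badtriple (R S : comNzRingType) (f : {rmorphism R -> S}) s t i :
  map_mx f (badtriple s t i) = badtriple s (f \o t) i.
Proof.
have mE p q (h : 'I_p -> 'I_q -> R) :
    map_mx f (\matrix_(r, c) h r c) = \matrix_(r, c) f (h r c).
  by apply/matrixP => r c; rewrite !mxE.
by rewrite /badtriple map_mxM map_perm_mx map_col_mx map_mxB !map_mxM /= !mE.
Qed.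

(** Write X = T [1 | X'] S with S a permutation matrix, and let C and B be the upper and lower
    blocks of S A_i. The inclusion gives C + X' B = P_i Y, so C is recovered from the other data. *)
Lemma badtripleP (F : fieldType) (A : 'I_3 -> 'M[F]_n) (X : 'M_(a, n))
    (Y : 'M_(b, n)) : row_free X -> (forall i, (X *m A i <= Y)%MS) ->
  exists s t, forall i, A i = badtriple s t i.
Proof.
move=> /row_free_perm_decomp[s [T [X' [uT XE]]]] XA.
pose P i := invmx T *m (X *m A i *m pinvmx Y).
have PY i : P i *m Y = row_mx 1%:M X' *m (perm_mx s *m A i).
  by rewrite /P -mulmxA mulmxKpV // XE -!mulmxA mulKmx.
pose t (j : badparam) := match j with
  | inl (inl (r, c)) => X' r c
  | inl (inr (i, r, c)) => dsubmx (perm_mx s *m A i) r c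
  | inr (inl (i, r, c)) => P i r c
  | inr (inr (r, c)) => Y r c end.
exists s^-1%g, t => i; rewrite /badtriple.
have -> : \matrix_(r, c) t (inl (inl (r, c))) = X'.
  by apply/matrixP=> r c; rewrite mxE.
have -> : \matrix_(r, c) t (inl (inr (i, r, c))) = dsubmx (perm_mx s *m A i).
  by apply/matrixP=> r c; rewrite mxE.
have -> : \matrix_(r, c) t (inr (inl (i, r, c))) = P i.
  by apply/matrixP=> r c; rewrite mxE.
have -> : \matrix_(r, c) t (inr (inr (r, c))) = Y.
  by apply/matrixP=> r c; rewrite mxE.
rewrite PY -[X in row_mx _ _ *m X]vsubmxK mul_row_col mul1mx addrK vsubmxK.
by rewrite mulmxA -perm_mxM mulVg perm_mx1 mul1mx.
Qed.

Lemma card_badparam :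
  #|badparam| = (a * m + 3 * m * n + (3 * a * b + b * n))%N.
Proof. by rewrite !(card_sum, card_prod, card_ord). Qed.

(** The number of parameters is 3n^2 - (2a - b)n - a^2 + 3ab, which the two hypotheses make less
    than 3n^2. *)
Lemma thin_bad (F : fieldType) : (b < 2 * a)%N -> (3 * a * b < n)%N ->
  thin (fun x : 'I_3 * 'I_n * 'I_n -> F =>
    exists (X : 'M_(a, n)) (Y : 'M_(b, n)),
    row_free X /\ forall i, (X *m (\matrix_(r, c) x (i, r, c)) <= Y)%MS).
Proof.
move=> ba abn.
pose p (s : 'S_n) (j : 'I_3 * 'I_n * 'I_n) : {mpoly F[#|badparam|]} :=
  badtriple s (fun t => 'X_(enum_rank t)) j.1.1 j.1.2 j.2.
have cN : (#|badparam| < #|{: 'I_3 * 'I_n * 'I_n}|)%N.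
  rewrite card_badparam !card_prod !card_ord.
  have : n = (a + m)%N by [].
  clearbody n; nia.
apply: thin_sub (thin_exists (fun s => thin_image (p s) cN)).
move=> x [X [Y [Xfree XY]]]; have [s [t tE]] := badtripleP Xfree XY.
exists s, (t \o enum_val) => -[[i r] c]; rewrite /p /=.
have := tE i => /matrixP/(_ r c); rewrite mxE => ->.
set v := t \o _.
have -> : badtriple s t i =
    map_mx (meval v) (badtriple s (fun t => 'X_(enum_rank t)) i).
  rewrite map_badtriple; congr (badtriple s _ i).
  by apply/funext => j /=; rewrite mevalXU /v /= enum_rankK.
by rewrite mxE.
Qed.

End BadTriples.

Lemma expanding_triple (F : fieldType) (L : nat) : [pchar F] =i pred0 ->
  exists n (A : 'I_3 -> 'M[F]_n), (0 < n)%N /\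
  forall a b (X : 'M_(a, n)) (Y : 'M_(b, n)), (a <= L)%N -> row_free X ->
    (forall i, (X *m A i <= Y)%MS) -> (2 * a <= b)%N.
Proof.
(* For a <= L and b < 2a, this ensures 3ab < n and a <= n. *)
move=> F0; pose n := (6 * L * L + L).+1.
pose bad a b (x : 'I_3 * 'I_n * 'I_n -> F) :=
  exists (X : 'M_(a, n)) (Y : 'M_(b, n)),
    row_free X /\ forall i, (X *m (\matrix_(r, c) x (i, r, c)) <= Y)%MS.
have tbad a b : (a <= L)%N -> (b < 2 * a)%N -> thin (bad a b).
  move=> aL ba; have abn : (3 * a * b < n)%N by rewrite /n; nia.
  have nE : n = (a + (n - a))%N by rewrite /n; lia.
  rewrite /bad; clearbody n; move: nE abn; move: (n - a)%N => m nE.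
  by rewrite {}nE => abn; exact: thin_bad.
have {tbad} tbad : thin (fun x => exists ab : 'I_L.+1 * 'I_(2 * L),
    (ab.2 < 2 * ab.1)%N /\ bad ab.1 ab.2 x).
  apply: thin_exists => -[a b] /=; have [ba|ba] := ltnP b (2 * a).
    by apply: thin_sub (tbad a b _ ba) => [x []//|]; rewrite -ltnS.
  by apply: thin_sub (thin0 _ _) => x [].
have [|x xP] := thin_avoid F0 _ tbad; first by rewrite !card_prod !card_ord.
exists n, (fun i => \matrix_(r, c) x (i, r, c)); split=> // a b X Y aL Xfree XY.
rewrite leqNgt; apply/negP => ba; apply: xP.
have bL : (b < 2 * L)%N by lia.
by exists (inord a, Ordinal bL); rewrite /= inordK //; split=> //; exists X, Y.
Qed.

(** * Modules over the path algebra *)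

HB.instance Definition _ (k : fieldType) (A : falgType k) (M : fdmod A)
    (a : A) :=
  GRing.isLinear.Build k M M *:%R (act a) (act_linearr a).

(** * Embeddings between modules *)

Section Embeddings.
Variables (k : fieldType) (A : falgType k).
Implicit Types M N : fdmod A.

Definition embeds N M : Prop := exists f : 'Hom(N, M),
  injective f /\ forall a u, f (act a u) = act a (f u).

Definition dsum_inl M N (u : M) : dsum2 M N := (u, 0).
Definition dsum_inr M N (u : N) : dsum2 M N := (0, u).

Fact dsum_inl_linear M N : linear (@dsum_inl M N).
Proof. by move=> c u v; congr pair; rewrite /= scaler0 addr0. Qed.

Fact dsum_inr_linear M N : linear (@dsum_inr M N).
Proof. by move=> c u v; congr pair; rewrite /= scaler0 addr0. Qed.

HB.instance Definition _ M N :=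
  GRing.isLinear.Build k M (dsum2 M N) *:%R (@dsum_inl M N)
    (@dsum_inl_linear M N).
HB.instance Definition _ M N :=
  GRing.isLinear.Build k N (dsum2 M N) *:%R (@dsum_inr M N)
    (@dsum_inr_linear M N).

Lemma act0r M (a : A) : act a (0 : M) = 0.
Proof. exact: linear0. Qed.

Lemma actD M a (u v : M) : act a (u + v) = act a u + act a v.
Proof. exact: linearD. Qed.

Lemma act_inl M N a (u : M) : act a (dsum_inl N u) = dsum_inl N (act a u).
Proof. by congr pair; rewrite /= act0r. Qed.

Lemma act_inr M N a (u : N) : act a (dsum_inr M u) = dsum_inr M (act a u).
Proof. by congr pair; rewrite /= act0r. Qed.

Lemma embeds_trans N M P : embeds N M -> embeds M P -> embeds N P.
Proof.
move=> [f [finj fA]] [g [ginj gA]]; exists (g \o f)%VF; split.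
  by move=> u v; rewrite !comp_lfunE => /ginj/finj.
by move=> a u; rewrite !comp_lfunE fA gA.
Qed.

Lemma embeds_inl M N : embeds M (dsum2 M N).
Proof.
exists (linfun (@dsum_inl M N)); split=> [u v|a u]; rewrite !lfunE /=.
  by case.
exact/esym/act_inl.
Qed.

Lemma embeds_inr M N : embeds N (dsum2 M N).
Proof.
exists (linfun (@dsum_inr M N)); split=> [u v|a u]; rewrite !lfunE /=.
  by case.
exact/esym/act_inr.
Qed.

Lemma embeds_submod M (U : {vspace M}) (hU : is_submod U) :
  embeds (submod hU) M.
Proof.
exists (linfun (vsval : subvs_of U -> M)); split=> [u v|a u]; rewrite !lfunE /=.
  exact: val_inj.
exact: val_sub_act.
Qed.

Lemma mod_iso_embeds M N : mod_iso M N -> embeds N M.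
Proof.
move=> [f [fbij fA]]; have finj := bij_inj fbij.
have fK u : f ((f^-1)%VF u) = u.
  apply: limg_lfunVK.
  by case: fbij => g _ gK; rewrite -(gK u) memv_img ?memvf.
exists (f^-1)%VF; split=> [u v uv|a u]; first by rewrite -(fK u) uv fK.
by apply: finj; rewrite fA !fK.
Qed.

Lemma mod_iso_mdim M N : mod_iso M N -> (mdim M <= mdim N)%N.
Proof.
move=> [f [/bij_inj/lker0P/eqP kf _]].
rewrite /mdim -(@limg_dim_eq _ _ _ f fullv).
  exact/dimvS/subvf.
by rewrite kf capv0.
Qed.

End Embeddings.

Section KroneckerModules.
Variables (k : fieldType) (d : nat).
Local Notation KA := (kronecker_alg k d).
Implicit Types M N : fdmod KA.

Definition kpath_elt (p : kpath d) : KA := [ffun q => (q == p)%:R].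
Definition idem (v : bool) : KA := kpath_elt (inl v).
Definition arrow (i : 'I_d) : KA := kpath_elt (inr i).

Lemma kmulE (x y : KA) : x * y = kmul x y. Proof. by []. Qed.

Lemma idemM v : idem v * idem v = idem v.
Proof.
apply/ffunP => -[w|i]; rewrite kmulE ?kmul_inl ?kmul_inr !ffunE.
  by case: eqP; rewrite ?mulr1 ?mulr0.
by rewrite /= !(mulr0, mul0r) addr0.
Qed.

Lemma idemMC v : idem v * idem (~~ v) = 0.
Proof.
apply/ffunP => -[w|i]; rewrite kmulE ?kmul_inl ?kmul_inr !ffunE.
  by case: v w => [] []; rewrite /= ?mulr0 ?mul0r.
by rewrite /= !(mulr0, mul0r) addr0.
Qed.

Lemma idemD : idem false + idem true = 1.
Proof.
by apply/ffunP => -[[]|i]; rewrite !ffunE /= ?addr0 ?add0r.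
Qed.

Lemma idem_arrow i : idem true * arrow i = arrow i.
Proof.
apply/ffunP => -[w|j]; rewrite kmulE ?kmul_inl ?kmul_inr !ffunE /= ?mulr0 //.
by rewrite mul1r addr0.
Qed.

Definition vertex_space v N : {vspace N} :=
  limg (linfun (act (idem v) : N -> N)).

Lemma vertex_spaceP v N (u : N) :
  reflect (act (idem v) u = u) (u \in vertex_space v N).
Proof.
apply: (iffP memv_imgP) => [[w _ ->]|uE].
  by rewrite lfunE /= -actM idemM.
by exists u; rewrite ?memvf // lfunE.
Qed.

Lemma act0l N (u : N) : act (0 : KA) u = 0.
Proof.
have := act_linearl u (-1) 0 0.
by rewrite scaler0 addr0 scaleN1r addNr.
Qed.

Lemma act_idemD N (u : N) : u = act (idem false) u + act (idem true) u.
Proof.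
by rewrite -{1}(act1 u) -idemD -[idem false]scale1r act_linearl !scale1r.
Qed.

Lemma dim_vertex_spaces N :
  (\dim (vertex_space false N) + \dim (vertex_space true N))%N = mdim N.
Proof.
rewrite -dimv_disjoint_sum.
  congr (\dim _); apply/vspaceP => u; rewrite memvf; apply/memv_addP.
  exists (act (idem false) u).
    by apply/vertex_spaceP; rewrite -actM idemM.
  exists (act (idem true) u); first by apply/vertex_spaceP; rewrite -actM idemM.
  exact: act_idemD.
apply/eqP; rewrite -subv0; apply/subvP => u.
rewrite memv_cap => /andP[/vertex_spaceP <- /vertex_spaceP <-].
by rewrite -actM (idemMC true) act0l mem0v.
Qed.

Lemma vertex_space_dsum2 v M N : vertex_space v (dsum2 M N) =
  (linfun (@dsum_inl k KA M N) @: vertex_space v M +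
   linfun (@dsum_inr k KA M N) @: vertex_space v N)%VS.
Proof.
apply/vspaceP => u; apply/vertex_spaceP/memv_addP.
  case: u => u1 u2 [u1E u2E]; exists (dsum_inl N u1).
    by apply/memv_imgP; exists u1; rewrite ?lfunE //; apply/vertex_spaceP.
  exists (dsum_inr M u2); last by congr pair; rewrite /= ?addr0 ?add0r.
  by apply/memv_imgP; exists u2; rewrite ?lfunE //; apply/vertex_spaceP.
move=> [_ /memv_imgP[w1 /vertex_spaceP w1E ->]].
move=> [_ /memv_imgP[w2 /vertex_spaceP w2E ->] ->].
by rewrite !lfunE actD act_inl act_inr w1E w2E.
Qed.

Lemma dim_vertex_space_dsum2 v M N : \dim (vertex_space v (dsum2 M N)) =
  (\dim (vertex_space v M) + \dim (vertex_space v N))%N.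
Proof.
have /lker0P/eqP kl : injective (linfun (@dsum_inl k KA M N)).
  by move=> u w; rewrite !lfunE => -[].
have /lker0P/eqP kr : injective (linfun (@dsum_inr k KA M N)).
  by move=> u w; rewrite !lfunE => -[].
rewrite vertex_space_dsum2 dimv_disjoint_sum.
  by rewrite (limg_dim_eq (U := vertex_space v M)) ?kl ?capv0 //
    (limg_dim_eq (U := vertex_space v N)) ?kr ?capv0.
apply/eqP; rewrite -subv0; apply/subvP => u; rewrite memv_cap.
move=> /andP[/memv_imgP[w1 _ ->] /memv_imgP[w2 _]]; rewrite !lfunE => -[-> _].
by rewrite -(lfunE (@dsum_inl _ _ _ _)) linear0 mem0v.
Qed.

(** Both sides are additive in [N], so the property passes to direct sums whatever the number of
    summands. *)
Definition expansive N : Prop :=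
  (2 * \dim (vertex_space false N) <= \dim (vertex_space true N))%N.

Lemma expansive_dsum2 M N : expansive M -> expansive N -> expansive (dsum2 M N).
Proof.
move=> eM eN; rewrite /expansive !dim_vertex_space_dsum2 mulnDr.
exact: leq_add.
Qed.

Lemma expansive_zeromod : expansive (zeromod KA).
Proof.
have /eqP := dim_vertex_spaces (zeromod KA).
rewrite /mdim dimvf /dim /= muln0 addn_eq0 => /andP[/eqP e0 _].
by rewrite /expansive e0 muln0.
Qed.

(** * The representation (k^n, k^n) given by a family of matrices *)

Section TripleModule.
Variables (n : nat) (T : 'I_d -> 'M[k]_n).
Local Notation V := ('rV[k]_n * 'rV[k]_n)%type.

Definition triple_act (x : KA) (u : V) : V :=
  (x (inl false) *: u.1,
   x (inl true) *: u.2 + \sum_i x (inr i) *: (u.1 *m T i)).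

Fact triple_act_linearl u : linear (triple_act^~ u).
Proof.
move=> c x y.
have sA (a b : k) (w : 'rV[k]_n) : (a *: (b : k^o) : k) *: w = a *: (b *: w).
  exact/esym/scalerA.
congr pair; rewrite /= !ffunE scalerDl sA // scalerDr [RHS]addrACA.
rewrite scaler_sumr -big_split /=; congr (_ + _).
by apply: eq_bigr => i _; rewrite !ffunE scalerDl sA.
Qed.

Fact triple_act_linearr x : linear (triple_act x).
Proof.
move=> c u v; congr pair; rewrite /= scalerDr !scalerA ?[_ * c]mulrC //.
rewrite scalerDr scalerA addrACA scaler_sumr -big_split /=.
congr (_ + _); apply: eq_bigr => i _.
by rewrite mulmxDl -scalemxAl scalerDr !scalerA mulrC.
Qed.

Fact triple_act1 u : triple_act 1 u = u.
Proof.
case: u => u v; congr pair; rewrite /= !ffunE !scale1r // big1 ?addr0 // => i _.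
by rewrite ffunE scale0r.
Qed.

Fact triple_actM x y u : triple_act (x * y) u = triple_act x (triple_act y u).
Proof.
congr pair; rewrite /= kmulE kmul_inl ?scalerA // scalerDr scalerA -addrA.
congr (_ + _); rewrite scaler_sumr -big_split /=; apply: eq_bigr => i _.
by rewrite kmul_inr scalerDl -scalemxAl !scalerA.
Qed.

Definition triple_mod : fdmod KA :=
  FdMod triple_act_linearl triple_act_linearr triple_act1 triple_actM.

Definition vcomp (v : bool) (u : triple_mod) : 'rV[k]_n :=
  if v then u.2 else u.1.

Lemma vcomp_sum v (J : finType) (F : J -> triple_mod) :
  vcomp v (\sum_j F j) = \sum_j vcomp v (F j).
Proof. by case: v; [apply: (raddf_sum snd)|apply: (raddf_sum fst)]. Qed.

Lemma vcompZ v c u : vcomp v (c *: u) = c *: vcomp v u.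
Proof. by case: v. Qed.

Lemma vcomp_idem v u : vcomp (~~ v) (act (idem v) u) = 0.
Proof.
case: v; rewrite /= !ffunE !scale0r // big1 ?addr0 // => i _.
by rewrite ffunE scale0r.
Qed.

Lemma vcomp_eq0 v u : vcomp v u = 0 -> vcomp (~~ v) u = 0 -> u = 0.
Proof. by case: u v => u1 u2 [] /= -> ->. Qed.

Lemma vcomp_arrow i u : vcomp true (act (arrow i) u) = vcomp false u *m T i.
Proof.
rewrite /= !ffunE scale0r add0r (bigD1 i) //= ffunE eqxx scale1r.
by rewrite big1 ?addr0 // => j ji; rewrite ffunE [_ == _](negPf ji) scale0r.
Qed.

Lemma mdim_triple_mod : mdim triple_mod = (n + n)%N.
Proof. by rewrite /mdim dimvf /dim /= /dim /= !mul1n. Qed.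

Section Frame.
Variables (N : fdmod KA) (f : 'Hom(N, triple_mod)).
Hypotheses (finj : injective f) (fA : forall a u, f (act a u) = act a (f u)).

Definition frame v : 'M[k]_(\dim (vertex_space v N), n) :=
  \matrix_(i < \dim (vertex_space v N))
    vcomp v (f (vbasis (vertex_space v N))`_i).

Lemma mul_frame v (w : 'rV_(\dim (vertex_space v N))) : w *m frame v =
  vcomp v (f (\sum_i w 0 i *: (vbasis (vertex_space v N))`_i)).
Proof.
rewrite linear_sum vcomp_sum mulmx_sum_row; apply: eq_bigr => i _.
by rewrite linearZ vcompZ rowK.
Qed.

(** On the vertex space of [v] the other component of [f] vanishes, so [vcomp v] composed with [f]
    is still injective there. *)
Lemma frame_free v : row_free (frame v).
Proof.
apply: inj_row_free => w; rewrite mul_frame; set u := \sum_i _ => u0.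
have uV : act (idem v) u = u.
  apply/vertex_spaceP/memv_suml => i _; apply/memvZ/vbasis_mem/mem_nth.
  by rewrite size_tuple.
have fu0 : f u = 0 by apply: (vcomp_eq0 u0); rewrite -uV fA vcomp_idem.
have {u0 uV fu0} u0 : u = 0 by apply: finj; rewrite fu0 linear0.
have /freeP bfree := basis_free (vbasisP (vertex_space v N)).
by apply/rowP => i; rewrite mxE (bfree _ u0).
Qed.

Lemma frame_arrow i : (frame false *m T i <= frame true)%MS.
Proof.
apply/row_subP => r; rewrite row_mul rowK -vcomp_arrow -fA.
set u := act _ _; have uV : u \in vertex_space true N.
  by apply/vertex_spaceP; rewrite -actM idem_arrow.
rewrite (coord_vbasis uV).
have := mul_frame (\row_i coord (vbasis (vertex_space true N)) i u).
under [X in vcomp true (f X)]eq_bigr => j _ do rewrite mxE.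
by move=> <-; exact: submxMl.
Qed.

End Frame.

Lemma dim_vertex_space_le (N : fdmod KA) v : embeds N triple_mod ->
  (\dim (vertex_space v N) <= n)%N.
Proof.
by move=> [f [finj fA]]; rewrite -(eqP (frame_free finj fA v)) rank_leq_col.
Qed.

Variable L : nat.
Hypothesis Texp : forall a b (X : 'M_(a, n)) (Y : 'M_(b, n)), (a <= L)%N ->
  row_free X -> (forall i, (X *m T i <= Y)%MS) -> (2 * a <= b)%N.

Lemma small_expansive (N : fdmod KA) :
  embeds N triple_mod -> (mdim N <= L)%N -> expansive N.
Proof.
move=> [f [finj fA]] NL; apply: Texp (frame_free finj fA false) _.
  by apply: leq_trans NL; exact/dimvS/subvf.
exact: frame_arrow.
Qed.

(** Each summand embeds through the sum, so [small_expansive] applies to it; the bound [L] concerns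
    summands only, never [t]. *)
Lemma dsum_expansive t (Ns : 'I_t -> fdmod KA) :
  (forall i, (mdim (Ns i) <= L)%N) ->
  embeds (dsum Ns) triple_mod -> expansive (dsum Ns).
Proof.
rewrite /dsum; elim: t Ns => [|t IHt] Ns NsL; rewrite ?big_ord0 ?big_ord_recl.
  by move=> _; exact: expansive_zeromod.
move=> emb; apply: expansive_dsum2.
  by apply: small_expansive => //; exact: embeds_trans (embeds_inl _ _) emb.
by apply: IHt => //; exact: embeds_trans (embeds_inr _ _) emb.
Qed.

End TripleModule.
End KroneckerModules.

Theorem theorem22 (R : realType) (k : fieldType)
  (char_k : [pchar k]%R =i pred0) :
  ~ amenable_rep_type R (kronecker_alg k 3).
Proof.
move=> /(_ (1 / 8%:R)) [|L [_ hyp]]; first by rewrite divr_gt0 ?ltr0n.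
have [n [T [n0 Texp]]] := expanding_triple (Num.truncn L) char_k.
have [U [hU [Ubig [t [Ns [NsL iso]]]]]] := hyp (triple_mod T) I.
have embN : embeds (dsum Ns) (triple_mod T).
  exact: embeds_trans (mod_iso_embeds iso) (embeds_submod hU).
have : expansive (dsum Ns).
  apply: (dsum_expansive Texp) embN => i.
  by rewrite Num.Theory.truncn_ge_nat // (le_trans _ (NsL i)).
have h1 := dim_vertex_space_le true embN.
have := mod_iso_mdim iso; rewrite -(dim_vertex_spaces (dsum Ns)) => Ule e.
(* With N the direct sum, 2 dim U <= 2 dim N_1 + 2 dim N_2 <= 3 dim N_2 <= 3n, against dim U >=
   (7/8) 2n. *)
have {}Ule : (2 * mdim (submod hU) <= 3 * n)%N.
  rewrite (leq_trans (leq_mul (leqnn 2) Ule)) // mulnDr.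
  by rewrite (leq_trans (leq_add e (leqnn _))) // -mulSn leq_mul2l h1 orbT.
have {}Ule : 2 * (mdim (submod hU))%:R <= 3 * n%:R :> R.
  by rewrite -!natrM ler_nat.
have nR : 0 < n%:R :> R by rewrite ltr0n.
move: Ubig Ule nR; rewrite mdim_triple_mod natrD; lra.
Qed.
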